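(* Let $r\le s$ be positive integers and $M\cong\mathbb{A}^{rs}$ the space of complex $r\times s$ matrices, with arc space $M_\infty$ acted on by $G_\infty$ where $G=GL_r\times GL_s$. For pre-partitions $\lambda,\mu$ of length at most $r$, let $O_\lambda,O_\mu\subset M_\infty$ be the associated orbits. Then $O_\mu$ is contained in the Zariski closure of $O_\lambda$ if and only if \[ \lambda_{r-i}+\lambda_{r-i+1}+\dots+\lambda_r\ \le\ \mu_{r-i}+\mu_{r-i+1}+\dots+\mu_r \quad\text{for all } i\in\{0,\dots,r-1\}. \] In other words, the map $\lambda\mapsto O_\lambda$ is an order-reversing isomorphism from the set of pre-partitions of length at most $r$ ordered by co-domination onto the set of $G_\infty$-orbits in $M_\infty$ ordered by ''$O'\le O$ iff $O'$ is contained in the closure of $O$''.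
   Context: For a variety $X$ over $\mathbb{C}$, the arc space $X_\infty$ is the inverse limit of the jet schemes $X_n$ (which represent $A\mapsto\mathrm{Hom}(\mathrm{Spec}\,A[t]/(t^{n+1}),X)$); its $\mathbb{C}$-points for $X=M$ are $r\times s$ matrices with entries in $\mathbb{C}[[t]]$. The group $G=GL_r\times GL_s$ acts on $M$ by $(g,h)\cdot A=gAh^{-1}$, and functoriality gives an action of the group $G_\infty$ (pairs of invertible matrices over $\mathbb{C}[[t]]$) on $M_\infty$. Let $\overline{\mathbb N}=\mathbb N\cup\{\infty\}$ with $\infty>n$ and $\infty+n=\infty$ for all $n$. A pre-partition of length at most $r$ is a sequence $\lambda=(\lambda_1\ge\lambda_2\ge\dots\ge\lambda_r\ge0)$ of elements of $\overline{\mathbb N}$. For such $\lambda$, $\delta_\lambda$ is the $r\times s$ matrix over $\mathbb{C}[[t]]$ whose first $s-r$ columns are zero and whose last $r$ columns form the diagonal matrix $\mathrm{diag}(t^{\lambda_1},\dots,t^{\lambda_r})$, with the convention $t^\infty=0$; $O_\lambda$ is the $G_\infty$-orbit of $\delta_\lambda$. Co-domination: $\lambda\lhd\mu$ iff $\lambda_i+\dots+\lambda_r\le\mu_i+\dots+\mu_r$ for all $i$. *)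

(* Defs.v *)
From HB Require Import structures.
From mathcomp Require Import all_boot all_order all_algebra.
From mathcomp Require Import complex.
From mathcomp Require Import Rstruct.
From Stdlib Require Rdefinitions.
Set Implicit Arguments. Unset Strict Implicit. Unset Printing Implicit Defensive.
Import GRing.Theory Num.Theory.
Local Open Scope ring_scope.

Definition CC : fieldType := (Rdefinitions.R)[i].

Definition pser := nat -> CC.
Definition ps0 : pser := fun _ => 0.
Definition ps1 : pser := fun k => if k == 0%N then 1 else 0.
Definition psadd (a b : pser) : pser := fun k => a k + b k.
Definition psmul (a b : pser) : pser :=
  fun k => \sum_(i < k.+1) a i * b (k - i)%N.

Definition psmx (m n : nat) := 'I_m -> 'I_n -> pser.
Definition psmx_mul m n p (A : psmx m n) (B : psmx n p) : psmx m p :=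
  fun i j k => \sum_(l < n) psmul (A i l) (B l j) k.
Definition psmx_id n : psmx n n := fun i j => if i == j then ps1 else ps0.
Definition psmx_inverse n (g ginv : psmx n n) : Prop :=
  psmx_mul g ginv = @psmx_id n /\ psmx_mul ginv g = @psmx_id n.

(* C-points of the arc space M_oo of r x s matrices. *)
Definition arcM (r s : nat) := psmx r s.

Definition Goo_orbit r s (A : arcM r s) : arcM r s -> Prop :=
  fun B => exists (g ginv : psmx r r) (h hinv : psmx s s),
    psmx_inverse g ginv /\ psmx_inverse h hinv /\
    B = psmx_mul (psmx_mul g A) hinv.

(* Regular functions on M_oo: polynomials in the coordinates x_{ij}^{(k)}
   (coefficient of t^k in entry (i,j)). *)
Inductive arc_poly (r s : nat) : Type :=
| APConst of CC
| APVar of 'I_r & 'I_s & nat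
| APAdd of arc_poly r s & arc_poly r s
| APMul of arc_poly r s & arc_poly r s.

Fixpoint arc_eval r s (p : arc_poly r s) (A : arcM r s) : CC :=
  match p with
  | APConst c => c
  | APVar i j k => A i j k
  | APAdd p q => arc_eval p A + arc_eval q A
  | APMul p q => arc_eval p A * arc_eval q A
  end.

Definition in_zariski_closure r s (S : arcM r s -> Prop) (B : arcM r s) : Prop :=
  forall p : arc_poly r s, (forall A, S A -> arc_eval p A = 0) -> arc_eval p B = 0.

Inductive enat := Fin of nat | Inf.
Definition enat_le (a b : enat) : bool :=
  match a, b with
  | _, Inf => true
  | Inf, Fin _ => false
  | Fin m, Fin n => (m <= n)%N
  end.
Definition enat_add (a b : enat) : enat :=
  match a, b with
  | Fin m, Fin n => Fin (m + n)
  | _, _ => Inf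
  end.

(* Pre-partitions of length at most r: lam 0 >= lam 1 >= ... >= lam (r-1)
   (index i : 'I_r stands for lambda_{i+1}). *)
Definition prepartition r (lam : 'I_r -> enat) : Prop :=
  forall i j : 'I_r, (i <= j)%N -> enat_le (lam j) (lam i).

Definition tail_sum r (lam : 'I_r -> enat) (j : nat) : enat :=
  \big[enat_add/Fin 0]_(l < r | (j <= l)%N) lam l.

Definition codominates r (lam mu : 'I_r -> enat) : Prop :=
  forall j : 'I_r, enat_le (tail_sum lam j) (tail_sum mu j).

Definition tpow (e : enat) : pser :=
  match e with
  | Fin n => fun k => if k == n then 1 else 0
  | Inf => ps0
  end.

(* delta_lambda: first s-r columns zero, last r columns diag(t^lam_1,...,t^lam_r) *)
Definition delta r s (lam : 'I_r -> enat) : arcM r s :=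
  fun i j => if (j : nat) == ((s - r) + i)%N then tpow (lam i) else ps0.

Definition O_orbit r s (lam : 'I_r -> enat) : arcM r s -> Prop :=
  Goo_orbit (@delta r s lam).
Arguments O_orbit {r} s lam.

(* Main.v *)
From HB Require Import structures.
Require Import Defs.
From mathcomp Require Import all_boot all_order all_algebra all_fingroup zify ring.
From mathcomp Require Import complex Rstruct boolp.
From Stdlib Require Rdefinitions.

(** Necessity: by expanding determinants, every [(r-j)]-minor of a matrix in the
    orbit of [delta_lambda] is divisible by [t] to the sum of the [r-j] smallest
    exponents.  So the coefficients of lower order of these minors are polynomials
    vanishing on [O_lambda], hence at [delta_mu], one of whose minors is exactly
    [t^(mu_{j+1} + ... + mu_r)].

    Sufficiency: a polynomial sees finitely many coefficients, so infinite exponents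
    may be replaced by a large integer.  Among integer exponents, codomination is
    generated by adding a unit to one exponent and by moving a unit from a larger to
    a smaller one.  These are the degenerations, as [e -> 0], of [t^b (t + e)] to
    [t^(b+1)] and of [t^b [[t^c, 0], [e, t]]] to [t^b [[t^c, 0], [0, t]]], where the
    matrix with [e <> 0] is equivalent to [t^b diag(t^(c+1), 1)].

    Every matrix lies in some orbit by reduction to Smith normal form, and the orbits
    are distinct because tail sums determine a pre-partition. *)

Set Implicit Arguments. Unset Strict Implicit. Unset Printing Implicit Defensive.
Import GRing.Theory Num.Theory.

(** * Codomination of integer sequences, generated by elementary moves of units *)

Definition add_unit r (lam : 'I_r -> nat) k l := (lam l + (l == k))%N.
(** The subtraction is truncated, so for distinct [i] and [k] a unit really leaves [i] only when
    [lam i] is positive. *)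
Definition move_unit r (lam : 'I_r -> nat) i k l := (lam l + (l == k) - (l == i))%N.

(** The start [j] is any natural number, so that the empty tail after the last index is
    available. *)
Definition ntail r (lam : 'I_r -> nat) j := \sum_(l < r | (j <= l)%N) lam l.

Lemma ntailD1 r (lam : 'I_r -> nat) (j : 'I_r) : ntail lam j = (lam j + ntail lam j.+1)%N.
Proof.
rewrite /ntail (bigD1 j) //=; congr (_ + _); apply: eq_bigl => l.
by rewrite ltn_neqAle andbC eq_sym.
Qed.

Lemma ntail_eq1 r (k : 'I_r) j : ntail (fun l => l == k : nat) j = (j <= k).
Proof.
rewrite /ntail big_mkcond (bigD1 k) //= eqxx big1 ?addn0; first by case: leqP.
by move=> l /negbTE ->; case: ifP.
Qed.

Lemma ntail_add_unit r (lam : 'I_r -> nat) k j : ntail (add_unit lam k) j = (ntail lam j + (j <= k))%N.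
Proof. by rewrite -ntail_eq1 -big_split. Qed.

Lemma ntail_move_unit r (lam : 'I_r -> nat) i k j : (0 < lam i)%N ->
  (ntail (move_unit lam i k) j + (j <= i) = ntail lam j + (j <= k))%N.
Proof.
move=> li; rewrite -!ntail_eq1 -!big_split /=; apply: eq_bigr => l _.
by rewrite /move_unit; case: eqP; case: (l =P i) => [->|]; lia.
Qed.

(* [lam] need not be sorted, so the steps do not have to preserve sortedness.  At the
   last index [j] where [lam] and [mu] differ, [lam j < mu j]: [lam j] may take a
   unit from outside unless some earlier tail sums already agree, in which case it takes
   one from the last index [i] before [j] with equal tail sums. *)
Lemma domination_ind r (mu : 'I_r -> nat) (P : ('I_r -> nat) -> Prop) :
  (forall i j : 'I_r, (i <= j)%N -> (mu j <= mu i)%N) ->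
  P mu -> (forall lam k, P (add_unit lam k) -> P lam) ->
  (forall lam i k, (lam k + 2 <= lam i)%N -> P (move_unit lam i k) -> P lam) ->
  forall lam, (forall j : 'I_r, (ntail lam j <= ntail mu j)%N) -> P lam.
Proof.
move=> mu_sorted Pmu Pincr Pmove lam.
(* The induction is on the gap between the sums of all tail sums, which every step below
   decreases. *)
pose S (lam : 'I_r -> nat) := \sum_(j < r) ntail lam j.
have [n] := ubnP (S mu - S lam); elim: n lam => // n IH lam Sn dom.
have S_lt lam' (j : 'I_r) : (forall l : 'I_r, ntail lam l <= ntail lam' l)%N ->
    (ntail lam j < ntail lam' j)%N -> (S lam < S lam')%N.
  move=> le lt; rewrite /S (bigD1 j) //= [ltnRHS](bigD1 j) //= -addSn leq_add //.
  by apply: leq_sum.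
have S_le lam' : (forall j : 'I_r, ntail lam' j <= ntail mu j)%N -> (S lam' <= S mu)%N.
  by move=> le; apply: leq_sum.
have [l0 l0P|eq] := pickP [pred l | lam l != mu l]; last first.
  suff -> : lam = mu by [].
  by apply/funext => l; apply/eqP; move/negbT: (eq l); rewrite negbK.
case: (arg_maxnP (fun l : 'I_r => l : nat) l0P) => j /= jne jmax.
have lmu_j : (lam j < mu j)%N.
  have := dom j; rewrite !ntailD1.
  have -> : ntail lam j.+1 = ntail mu j.+1.
    apply: eq_bigr => l jl; apply/eqP; rewrite -[_ == _]negbK; apply/negP => /jmax.
    by rewrite leqNgt jl.
  by rewrite leq_add2r ltn_neqAle jne.
have Tj : (ntail lam j < ntail mu j)%N.
  have -> : ntail mu j = (mu j + ntail lam j.+1)%N.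
    rewrite ntailD1; congr (_ + _)%N.
    apply: eq_bigr => l jl; apply/eqP; rewrite eq_sym -[_ == _]negbK; apply/negP => /jmax.
    by rewrite leqNgt jl.
  by rewrite ntailD1 ltn_add2r.
have [i0 i0P|neq] := pickP [pred i : 'I_r | (i < j)%N && (ntail lam i == ntail mu i)]; last first.
  apply: (Pincr _ j); have dom' (l : 'I_r) : (ntail (add_unit lam j) l <= ntail mu l)%N.
    rewrite ntail_add_unit; case: (ltngtP l j) => [lj|lj|/val_inj ->]; last by rewrite addn1.
      by rewrite addn1 ltn_neqAle dom andbT; move: (neq l) => /=; rewrite lj /= => ->.
    by rewrite addn0.
  apply: IH => //; have /S_le := dom'.
  have : (S lam < S (add_unit lam j))%N.
    by apply: (S_lt _ j) => [l|]; rewrite ntail_add_unit ?leq_addr // leqnn addn1.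
  by move: Sn; lia.
case: (arg_maxnP (fun l : 'I_r => l : nat) i0P) => i /= /andP[ij /eqP Ti] imax.
have Tij (l : 'I_r) : (i < l <= j)%N -> (ntail lam l < ntail mu l)%N.
  move=> /andP[il]; rewrite leq_eqVlt => /orP[/eqP/val_inj -> //|lj].
  rewrite ltn_neqAle dom andbT; apply/negP => Tl.
  by have := imax l; rewrite lj Tl => /(_ isT); rewrite leqNgt il.
(* The tail sums agree at [i], and at [i.+1] the one of [lam] is strictly smaller, so the term at
   [i] makes up the difference. *)
have lmu_i : (mu i < lam i)%N.
  have ri : (i.+1 < r)%N by apply: leq_ltn_trans (ltn_ord j).
  have := Tij (Ordinal ri); rewrite /= ltnSn ij => /(_ isT).
  by move: Ti; rewrite !ntailD1; lia.
(* The chain [lam j < mu j <= mu i < lam i] leaves a gap of at least two. *)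
have lji : (lam j + 2 <= lam i)%N.
  by have := mu_sorted i j (ltnW ij); lia.
have lam_i : (0 < lam i)%N by lia.
apply: (Pmove _ i j lji).
(* Only the tails starting after [i] and up to [j] grow, each by one, and exactly there [Tij] gives
   a strict inequality. *)
have dom' (l : 'I_r) : (ntail (move_unit lam i j) l <= ntail mu l)%N.
  have := ntail_move_unit j l lam_i; have := dom l; have := Tij l.
  by case: (leqP l i); case: (leqP l j) => /=; lia.
apply: IH => //; have /S_le := dom'.
have : (S lam < S (move_unit lam i j))%N.
  apply: (S_lt _ j) => [l|].
    by have := ntail_move_unit j l lam_i; case: (leqP l i); case: (leqP l j) => /=; lia.
  by have := ntail_move_unit j j lam_i; rewrite leqnn leqNgt ij; lia.
by move: Sn; lia.
Qed.

(** * Extended naturals and tail sums of pre-partitions *)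

Fact enat_addA : associative enat_add.
Proof. by move=> [a|] [b|] [c|] //=; rewrite addnA. Qed.
Fact enat_addC : commutative enat_add.
Proof. by move=> [a|] [b|] //=; rewrite addnC. Qed.
Fact enat_add0 : left_id (Fin 0) enat_add.
Proof. by case. Qed.
HB.instance Definition _ :=
  Monoid.isComLaw.Build enat (Fin 0) enat_add enat_addA enat_addC enat_add0.

Lemma enat_le_refl : reflexive enat_le.
Proof. by case=> /=. Qed.

Lemma enat_le_trans : transitive enat_le.
Proof. by move=> [a|] [b|] [c|] //=; apply: leq_trans. Qed.

Lemma enat_le_anti : forall a b, enat_le a b -> enat_le b a -> a = b.
Proof. by move=> [a|] [b|] //= ab ba; congr Fin; apply/eqP; rewrite eqn_leq ab. Qed.

Lemma enat_le_add a b c d : enat_le a b -> enat_le c d -> enat_le (enat_add a c) (enat_add b d).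
Proof. by move: a b c d => [a|] [b|] [c|] [d|] //=; apply: leq_add. Qed.

Lemma enat_le_sum (I : finType) (P : pred I) (f g : I -> enat) :
  (forall i, P i -> enat_le (f i) (g i)) ->
  enat_le (\big[enat_add/Fin 0]_(i | P i) f i) (\big[enat_add/Fin 0]_(i | P i) g i).
Proof. by move=> fg; apply: (big_ind2 enat_le) => // *; apply: enat_le_add. Qed.

Lemma tail_sum_image r (lam : 'I_r -> enat) (j : nat) (f0 : 'I_(r - j) -> 'I_r) :
  (forall x, f0 x = (j + x)%N :> nat) ->
  tail_sum lam j = \big[enat_add/Fin 0]_x lam (f0 x).
Proof.
move=> f0E; have f0_inj : injective f0.
  by move=> x y /(congr1 val) /=; rewrite !f0E => /addnI /val_inj.
rewrite -[RHS](big_imset lam (h := f0) (A := predT)) /=; last exact: in2W.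
apply: eq_bigl => l; apply/idP/imsetP => [jl|[x _ ->]]; last by rewrite f0E leq_addr.
have lj : (l - j < r - j)%N by have := ltn_ord l; lia.
by exists (Ordinal lj) => //; apply: val_inj; rewrite /= f0E /= subnKC.
Qed.

(* Exchange argument: the indices selected by [f] and the last [r - j] ones differ by
   equally many elements on either side of [j], where [lam] is compared with [lam j]. *)
Lemma tail_sum_min r (lam : 'I_r -> enat) (j : 'I_r) (f : 'I_(r - j) -> 'I_r) :
  prepartition lam -> injective f ->
  enat_le (tail_sum lam j) (\big[enat_add/Fin 0]_x lam (f x)).
Proof.
move=> lam_dec f_inj.
have lt_f0 (x : 'I_(r - j)) : (j + x < r)%N by have := ltn_ord x; lia.
pose f0 x := Ordinal (lt_f0 x).
have f0_inj : injective f0 by move=> x y /(congr1 val) /= /addnI /val_inj.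
rewrite (@tail_sum_image _ lam j f0) //.
pose A : {set 'I_r} := f @: 'I_(r - j); pose T : {set 'I_r} := f0 @: 'I_(r - j).
have -> : \big[enat_add/Fin 0]_x lam (f x) = \big[enat_add/Fin 0]_(l in A) lam l.
  by rewrite big_imset //=; apply: in2W.
have -> : \big[enat_add/Fin 0]_x lam (f0 x) = \big[enat_add/Fin 0]_(l in T) lam l.
  by rewrite big_imset //=; apply: in2W.
have cAT : #|A :\: T| = #|T :\: A|.
  apply: (@addnI #|A :&: T|); rewrite cardsID setIC cardsID.
  by rewrite !card_imset.
rewrite [X in enat_le X _](big_setID A) [X in enat_le _ X](big_setID T) /= setIC.
apply: enat_le_add; first exact: enat_le_refl.
apply: (@enat_le_trans (\big[enat_add/Fin 0]_(l in T :\: A) lam j)).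
  apply: enat_le_sum => l; rewrite inE => /andP[_ /imsetP[x _ ->]].
  by apply: lam_dec; rewrite /= leq_addr.
(* A constant sum depends only on the number of its terms, so it can be moved from [T :\: A] to
   [A :\: T]. *)
rewrite big_const -cAT -big_const.
apply: enat_le_sum => l; rewrite inE => /andP[lT _].
apply: lam_dec; rewrite leqNgt; apply: contra lT => jl.
have lj : (l - j < r - j)%N by have := ltn_ord l; lia.
by apply/imsetP; exists (Ordinal lj) => //; apply: val_inj; rewrite /= subnKC // ltnW.
Qed.

Lemma tail_sumD1 r (lam : 'I_r -> enat) (j : 'I_r) :
  tail_sum lam j = enat_add (lam j) (tail_sum lam j.+1).
Proof.
rewrite /tail_sum (bigD1 j) //=; congr enat_add; apply: eq_bigl => l.
by rewrite ltn_neqAle andbC eq_sym.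
Qed.

(** The default [N] stands in for infinity: modulo [t^N], both [t^N] and [t^Inf] are zero. *)
Definition enat_odflt N (e : enat) : nat := if e is Fin n then n else N.

(** A finite term forces all later ones to be finite, so [enat_odflt] replaces nothing from [j]
    on. *)
Lemma tail_sum_fin r (lam : 'I_r -> enat) (j : 'I_r) n i N : prepartition lam ->
  lam j = Fin n -> (j <= i)%N -> tail_sum lam i = Fin (ntail (enat_odflt N \o lam) i).
Proof.
move=> lam_dec lamj ji; rewrite /ntail (big_morph Fin (id1 := Fin 0) (op1 := enat_add)) //.
apply: eq_bigr => l il /=.
by have := lam_dec j l (leq_trans ji il); rewrite lamj; case: (lam l).
Qed.

(** If one sequence has a finite term at [j], its tail after [j] is finite too and cancels, so the
    other has the same term. Applied both ways, this also settles the infinite terms. *)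
Lemma tail_sum_inj r (lam mu : 'I_r -> enat) : prepartition lam -> prepartition mu ->
  (forall j : 'I_r, tail_sum lam j = tail_sum mu j) -> lam = mu.
Proof.
move=> lam_dec mu_dec tail_eq.
have tail_eqS (j : 'I_r) : tail_sum lam j.+1 = tail_sum mu j.+1.
  have [jr|rj] := ltnP j.+1 r; first exact: (tail_eq (Ordinal jr)).
  by rewrite /tail_sum !big1 // => l; have := ltn_ord l; lia.
suff H (a b : 'I_r -> enat) j n : prepartition a ->
    (forall j : 'I_r, tail_sum a j = tail_sum b j) ->
    (forall j : 'I_r, tail_sum a j.+1 = tail_sum b j.+1) -> a j = Fin n -> b j = Fin n.
  apply/funext => j; case E: (lam j) => [n|]; first by rewrite (H lam mu j n).
  by case E': (mu j) => [n|] //; rewrite -E (H mu lam j n).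
move=> a_dec ab abS aj; have := ab j; rewrite !tail_sumD1 -abS aj.
rewrite (@tail_sum_fin _ a j n _ 0 a_dec aj (leqnSn _)) /=.
by case: (b j) => //= m [] /addIn ->.
Qed.

(** Induction from the last index backwards. If [lam j] is finite, its tail is at most [N], hence
    bounded either by the finite tail of [mu] or by the [N] replacing [mu j]. If [lam j] is
    infinite, so is [mu j], and both contribute [N]. *)
Lemma codominates_odflt r (lam mu : 'I_r -> enat) N :
  prepartition lam -> prepartition mu -> codominates lam mu ->
  (\sum_l enat_odflt 0 (lam l) <= N)%N ->
  forall j : 'I_r, (ntail (enat_odflt N \o lam) j <= ntail (enat_odflt N \o mu) j)%N.
Proof.
move=> lam_dec mu_dec dom lamN j.
have [m] := ubnP (r - j); elim: m j => // m IH j jm.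
case E: (lam j) => [n|].
  have := dom j; rewrite (tail_sum_fin N lam_dec E (leqnn j)).
  have le_N : (ntail (enat_odflt N \o lam) j <= N)%N.
    apply: leq_trans lamN; rewrite [leqRHS](bigID (fun l : 'I_r => (j <= l)%N)) /=.
    apply: leq_trans (leq_addr _ _); apply: leq_sum => l jl /=.
    by have := lam_dec j l jl; rewrite E; case: (lam l).
  case E': (mu j) => [n'|]; first by rewrite (tail_sum_fin N mu_dec E' (leqnn j)).
  by move=> _; apply: leq_trans le_N _; rewrite [leqRHS]ntailD1 /= E' leq_addr.
have muj : mu j = Inf.
  case E': (mu j) => [n|] //; have := dom j.
  by rewrite (tail_sum_fin N mu_dec E' (leqnn j)) tail_sumD1 E.
rewrite !ntailD1 /= E muj leq_add2l.
have [jr|rj] := ltnP j.+1 r; first by apply: (IH (Ordinal jr)) => /=; lia.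
by rewrite /ntail big1 // => l; have := ltn_ord l; lia.
Qed.

(** Since [N] bounds every finite term, putting it in place of infinity keeps the order. *)
Lemma odflt_dec r (mu : 'I_r -> enat) N : prepartition mu ->
  (\sum_l enat_odflt 0 (mu l) <= N)%N ->
  forall i j : 'I_r, (i <= j)%N -> (enat_odflt N (mu j) <= enat_odflt N (mu i))%N.
Proof.
move=> mu_dec muN i j /mu_dec; have : (enat_odflt 0 (mu j) <= N)%N.
  by apply: leq_trans muN; rewrite (bigD1 j) //= leq_addr.
by case: (mu j) (mu i) => [m|] [n|].
Qed.

(** * The ring of formal power series over a field *)

Local Open Scope ring_scope.

(** A separate name on which the ring structure is declared; [ser CC] is convertible with [pser]. *)
Definition ser (R : Type) : Type := nat -> R.
HB.instance Definition _ R := gen_eqMixin (ser R).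
HB.instance Definition _ R := gen_choiceMixin (ser R).

Section SeriesRing.
Variable F : fieldType.
Local Notation ser := (ser F).

Definition ser_add (a b : ser) : ser := fun k => a k + b k.
Definition ser_mul (a b : ser) : ser :=
  fun k => \sum_(i < k.+1) a i * b (k - i)%N.
Definition ser_zero : ser := fun=> 0.
Definition ser_one : ser := fun k => if k == 0%N then 1 else 0.

Lemma serP (a b : ser) : (forall k, a k = b k) -> a = b.
Proof. by move=> ab; apply/funext. Qed.

Definition ser_opp (a : ser) : ser := fun k => - a k.

Fact ser_addA : associative ser_add.
Proof. by move=> a b c; apply: serP => k; rewrite /ser_add addrA. Qed.
Fact ser_addC : commutative ser_add.
Proof. by move=> a b; apply: serP => k; rewrite /ser_add addrC. Qed.
Fact ser_add0 : left_id ser_zero ser_add.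
Proof. by move=> a; apply: serP => k; rewrite /ser_add add0r. Qed.
Fact ser_addN : left_inverse ser_zero ser_opp ser_add.
Proof. by move=> a; apply: serP => k; rewrite /ser_add addNr. Qed.

HB.instance Definition _ :=
  GRing.isZmodule.Build ser ser_addA ser_addC ser_add0 ser_addN.

Definition trunc n (a : ser) : {poly F} := \poly_(i < n) a i.

Lemma coef_trunc n a k : (k < n)%N -> (trunc n a)`_k = a k.
Proof. by move=> kn; rewrite coef_poly kn. Qed.

(** A coefficient of a product only sees truncations, so commutativity and associativity are
    inherited from polynomials. *)
Lemma ser_mul_trunc n a b k : (k < n)%N -> ser_mul a b k = (trunc n a * trunc n b)`_k.
Proof.
move=> kn; rewrite coefM; apply: eq_bigr => i _.
by rewrite !coef_trunc // (leq_ltn_trans _ kn) ?leq_subr // -ltnS.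
Qed.

Fact ser_mulC : commutative ser_mul.
Proof.
by move=> a b; apply: serP => k; rewrite !(@ser_mul_trunc k.+1) // mulrC.
Qed.

Fact ser_mulA : associative ser_mul.
Proof.
move=> a b c; apply: serP => k; set n := k.+1.
(* The truncation of a product differs from the product of truncations, but not in degrees at most
   [k]. *)
have trM u v w : (trunc n u * trunc n (ser_mul v w))`_k
    = (trunc n u * (trunc n v * trunc n w))`_k.
  rewrite !coefM; apply: eq_bigr => i _; congr (_ * _).
  by rewrite coef_trunc ?ltnS ?leq_subr // -ser_mul_trunc // ltnS leq_subr.
rewrite (@ser_mul_trunc n) // trM ser_mulC (@ser_mul_trunc n) // trM.
by rewrite mulrA mulrC.
Qed.

Fact ser_mul1 : left_id ser_one ser_mul.
Proof.
move=> a; apply: serP => k.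
rewrite /ser_mul big_ord_recl /= /ser_one eqxx mul1r subn0.
rewrite [X in _ + X]big1 ?addr0 // => i _.
by rewrite mul0r.
Qed.

Fact ser_mulDl : left_distributive ser_mul +%R.
Proof.
move=> a b c; apply: serP => k; rewrite -[RHS]big_split /=.
by apply: eq_bigr => i _; rewrite -mulrDl.
Qed.

Fact ser_oner_neq0 : ser_one != 0.
Proof.
by apply/eqP => /(congr1 (fun a : ser => a 0%N)) /eqP; rewrite /ser_one eqxx oner_eq0.
Qed.

HB.instance Definition _ :=
  GRing.Zmodule_isComNzRing.Build ser ser_mulA ser_mulC ser_mul1 ser_mulDl
    ser_oner_neq0.

Definition coefs k (a : ser) : F := a k.
Fact coefs_is_zmod k : zmod_morphism (coefs k).
Proof. by []. Qed.
HB.instance Definition _ k := GRing.isZmodMorphism.Build ser F (coefs k) (coefs_is_zmod k).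


Lemma ser_sumE (I : Type) (s : seq I) (P : pred I) (f : I -> ser) k :
  (\sum_(i <- s | P i) f i) k = \sum_(i <- s | P i) f i k.
Proof. exact: (raddf_sum (coefs k)). Qed.

Lemma ser_mulE (a b : ser) k : (a * b) k = \sum_(i < k.+1) a i * b (k - i)%N.
Proof. by []. Qed.

Lemma ser_addE (a b : ser) k : (a + b) k = a k + b k. Proof. by []. Qed.
Lemma ser_oppE (a : ser) k : (- a) k = - a k. Proof. by []. Qed.
Lemma ser_oneE k : (1 : ser) k = (k == 0%N)%:R.
Proof. by rewrite [LHS]/(ser_one k) /ser_one; case: eqP. Qed.

Definition tp (n : nat) : ser := fun k => if k == n then 1 else 0.
Lemma tpE n k : tp n k = (k == n)%:R.
Proof. by rewrite /tp; case: eqP. Qed.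

Lemma tp_mulE n (a : ser) k : (tp n * a) k = if (n <= k)%N then a (k - n)%N else 0.
Proof.
rewrite ser_mulE; case: leqP => nk.
  rewrite (bigD1 (Ordinal (nk : (n < k.+1)%N))) //= tpE eqxx mul1r big1 ?addr0 // => i ni.
  rewrite tpE (_ : (_ == _) = false) ?mul0r //.
  by apply: contra_neqF ni => /eqP in_; apply: val_inj.
rewrite big1 // => i _; rewrite tpE (_ : (_ == _) = false) ?mul0r //.
by apply/negbTE; rewrite neq_ltn (leq_ltn_trans _ nk) // -ltnS.
Qed.

Lemma tpD m n : tp (m + n) = tp m * tp n.
Proof.
apply: serP => k; rewrite tp_mulE !tpE; case: leqP => mk.
  by rewrite -(eqn_add2l m (k - m)) subnKC.
by rewrite ltn_eqF // ltn_addr.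
Qed.

Lemma tp0 : tp 0 = 1.
Proof. by apply: serP => k; rewrite tpE ser_oneE. Qed.

Lemma tp_dvd n (a : ser) : (forall k, (k < n)%N -> a k = 0) -> exists b, a = tp n * b.
Proof.
move=> a0; exists (fun k => a (k + n)%N); apply: serP => k; rewrite tp_mulE.
by case: leqP => [/subnK -> //|]; apply: a0.
Qed.

Definition cst (c : F) : ser := fun k => if k == 0%N then c else 0.
Lemma cst_mulE c (a : ser) k : (cst c * a) k = c * a k.
Proof.
rewrite ser_mulE big_ord_recl /= /cst eqxx subn0 big1 ?addr0 // => i _.
by rewrite mul0r.
Qed.
Fact cst_is_zmod : zmod_morphism cst.
Proof. by move=> c d; apply: serP => -[|k]; rewrite /= ?[RHS]subr0. Qed.
Fact cst_is_monoid : monoid_morphism cst.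
Proof.
split; first by [].
by move=> c d; apply: serP => k; rewrite cst_mulE /cst; case: eqP; rewrite ?mulr0.
Qed.
HB.instance Definition _ := GRing.isZmodMorphism.Build F ser cst cst_is_zmod.
HB.instance Definition _ := GRing.isMonoidMorphism.Build F ser cst cst_is_monoid.

Lemma ser_expr_low (x : ser) n k : x 0%N = 0 -> (k < n)%N -> (x ^+ n) k = 0.
Proof.
move=> x0; have [y ->] : exists y, x = tp 1 * y by apply: tp_dvd => -[].
have tX m : tp 1 ^+ m = tp m.
  by elim: m => [|m IH]; rewrite ?expr0 ?tp0 // exprS IH -tpD.
by rewrite exprMn tX tp_mulE ltnNge => /negbTE ->.
Qed.

(* The inverse is the geometric series; its [k]-th coefficient only involves the
   powers [x ^+ i] with [i <= k]. *)
Lemma ser_inv1 (x : ser) : x 0%N = 0 -> exists y, (1 - x) * y = 1.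
Proof.
move=> x0; exists (fun k => (\sum_(i < k.+1) x ^+ i) k); apply: serP => n.
transitivity (((1 - x) * (\sum_(i < n.+1) x ^+ i)) n).
  rewrite !ser_mulE; apply: eq_bigr => j _; congr (_ * _).
  set m := (n - j)%N; have mn : (m.+1 <= n.+1)%N by rewrite ltnS leq_subr.
  rewrite !ser_sumE -!(big_mkord xpredT (fun i => (x ^+ i) m)).
  rewrite [RHS](big_cat_nat (leq0n _) mn) /= [X in _ + X]big_nat_cond.
  rewrite [X in _ + X]big1 ?addr0 // => i /andP[/andP[mi _] _].
  exact: ser_expr_low.
by rewrite -[X in X * _]opprB mulNr -subrX1 opprB ser_addE ser_oppE ser_expr_low ?subr0.
Qed.

(** Dividing by the constant coefficient reduces to a series [1 - x] with [x 0 = 0]. *)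
Lemma ser_inv (a : ser) : a 0%N != 0 -> exists b, a * b = 1.
Proof.
move=> a0; have [] := @ser_inv1 (1 - cst (a 0%N)^-1 * a).
  by rewrite ser_addE ser_oppE cst_mulE mulVf // ser_oneE subrr.
by move=> y; rewrite subKr => <-; exists (cst (a 0%N)^-1 * y); rewrite mulrCA mulrA.
Qed.

End SeriesRing.

(** * Equivalence of matrices over a commutative ring *)

Section MatrixEquivalence.
Variable R : comNzRingType.

(** Carrying the inverse explicitly makes sense over any commutative ring and matches
    [psmx_inverse]. *)
Definition mxinv n (g g' : 'M[R]_n) := g *m g' = 1%:M /\ g' *m g = 1%:M.

Definition mxeqv m n (A B : 'M[R]_(m, n)) :=
  exists g g' h h', [/\ mxinv g g', mxinv h h' & B = g *m A *m h].

Lemma mxinv1 n : mxinv (1%:M : 'M_n) 1%:M.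
Proof. by split; rewrite mulmx1. Qed.

Lemma mxinvM n (g g' h h' : 'M_n) : mxinv g g' -> mxinv h h' -> mxinv (g *m h) (h' *m g').
Proof.
move=> [gg' g'g] [hh' h'h]; split.
  by rewrite mulmxA -(mulmxA g) hh' mulmx1.
by rewrite mulmxA -(mulmxA h') g'g mulmx1.
Qed.

Lemma mxeqv_refl m n (A : 'M_(m, n)) : mxeqv A A.
Proof.
exists 1%:M, 1%:M, 1%:M, 1%:M; split; [exact: mxinv1 | exact: mxinv1 |].
by rewrite mul1mx mulmx1.
Qed.

Lemma mxeqv_sym m n (A B : 'M_(m, n)) : mxeqv A B -> mxeqv B A.
Proof.
move=> [g [g' [h [h' [[gg' g'g] [hh' h'h] ->]]]]].
exists g', g, h', h; split=> //.
by rewrite -!mulmxA hh' mulmx1 mulmxA g'g mul1mx.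
Qed.

Lemma mxeqv_trans m n (B A C : 'M_(m, n)) : mxeqv A B -> mxeqv B C -> mxeqv A C.
Proof.
move=> [g [g' [h [h' [ig ih ->]]]]] [k [k' [l [l' [ik il ->]]]]].
exists (k *m g), (g' *m k'), (h *m l), (l' *m h').
by split; [exact: mxinvM | exact: mxinvM | rewrite !mulmxA].
Qed.

Lemma mxeqv_mul m n (g g' : 'M_m) (h h' : 'M_n) (A : 'M_(m, n)) :
  mxinv g g' -> mxinv h h' -> mxeqv A (g *m A *m h).
Proof. by exists g, g', h, h'. Qed.

Lemma mxeqv_scale m n (a : R) (A B : 'M_(m, n)) : mxeqv A B -> mxeqv (a *: A) (a *: B).
Proof.
move=> [g [g' [h [h' [ig ih ->]]]]]; exists g, g', h, h'; split=> //.
by rewrite -!(scalemxAl, scalemxAr).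
Qed.

(* When [P *m P' = 1], this matrix acts as [g] on the image of [P'] and as the
   identity on the kernel of [P]. *)
Lemma mxinv_embed k n (P : 'M[R]_(k, n)) (P' : 'M[R]_(n, k)) (g g' : 'M_k) :
  P *m P' = 1%:M -> mxinv g g' ->
  mxinv (1%:M + P' *m (g - 1%:M) *m P) (1%:M + P' *m (g' - 1%:M) *m P).
Proof.
move=> PP'; suff H a b : a *m b = 1%:M -> (1%:M + P' *m (a - 1%:M) *m P) *m
    (1%:M + P' *m (b - 1%:M) *m P) = 1%:M by case=> ? ?; split; exact: H.
move=> ab; set p := P' *m (a - _) *m P; set q := P' *m (b - _) *m P.
have pq : p *m q = - p - q.
  have -> : p *m q = P' *m ((a - 1%:M) *m (b - 1%:M)) *m P.
    by rewrite /p /q !mulmxA -(mulmxA _ P) PP' mulmx1.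
  rewrite mulmxBl !mulmxBr ab !mul1mx mulmx1.
  by rewrite /p /q !mulmxBr !mulmxBl !mulmx1 [in RHS]opprB.
by rewrite mulmxDl mul1mx mulmxDr mulmx1 pq [p + _]addrA subrr add0r addrK.
Qed.

(** The matrix [X] is killed by [P] on the left and by [Q'] on the right, so the embedded invertible
    matrices fix it and act only on the block that [P] and [Q] select. *)
Lemma mxeqv_embed k l m n (P : 'M[R]_(k, m)) (P' : 'M[R]_(m, k))
    (Q : 'M[R]_(l, n)) (Q' : 'M[R]_(n, l)) (X : 'M_(m, n)) (D E : 'M_(k, l)) :
  P *m P' = 1%:M -> Q *m Q' = 1%:M -> P *m X = 0 -> X *m Q' = 0 ->
  mxeqv D E -> mxeqv (X + P' *m D *m Q) (X + P' *m E *m Q).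
Proof.
move=> PP' QQ' PX XQ' [g [g' [h [h' [ig ih ->]]]]].
have:= mxeqv_mul (X + P' *m D *m Q) (mxinv_embed PP' ig) (mxinv_embed QQ' ih).
have gX : (1%:M + P' *m (g - 1%:M) *m P) *m X = X.
  by rewrite mulmxDl mul1mx -mulmxA PX mulmx0 addr0.
have gP : (1%:M + P' *m (g - 1%:M) *m P) *m P' = P' *m g.
  by rewrite mulmxDl mul1mx -mulmxA PP' mulmx1 mulmxBr mulmx1 addrC subrK.
have Xh : X *m (1%:M + Q' *m (h - 1%:M) *m Q) = X.
  by rewrite mulmxDr mulmx1 !mulmxA XQ' !mul0mx addr0.
have Qh : Q *m (1%:M + Q' *m (h - 1%:M) *m Q) = h *m Q.
  by rewrite mulmxDr mulmx1 !mulmxA QQ' mul1mx mulmxBl mul1mx addrC subrK.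
move: gX gP Xh Qh; set G := 1%:M + _; set H := 1%:M + _ => gX gP Xh Qh.
by rewrite mulmxDr gX 2!mulmxA gP mulmxDl Xh -[_ *m Q *m _]mulmxA Qh !mulmxA.
Qed.

(** The case [X = 0] and [P = 1] of the embedding; it carries equivalences of square matrices to
    rectangular ones. *)
Lemma mxeqv_rowfree n m p (Q : 'M[R]_(n, p)) (Q' : 'M[R]_(p, n)) (D E : 'M_(m, n)) :
  Q *m Q' = 1%:M -> mxeqv D E -> mxeqv (D *m Q) (E *m Q).
Proof.
move=> QQ' DE; have:= @mxeqv_embed _ _ _ _ 1%:M 1%:M Q Q' 0 D E.
by rewrite !mul1mx !add0r mul0mx; apply.
Qed.

Lemma mxeqv_diag_unit n (d u : 'rV[R]_n) : (forall i, exists v, u 0 i * v = 1) ->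
  mxeqv (diag_mx d) (diag_mx (\row_i (d 0 i * u 0 i))).
Proof.
move=> uV; have [v uv] : exists v : 'rV_n, forall i, u 0 i * v 0 i = 1.
  elim: n d u uV => [|n IH] d u uV; first by exists 0 => -[].
  have [v0 uv0] := uV ord0; have [i|v uv] := IH 0 (\row_i u 0 (lift ord0 i)).
    by rewrite mxE; apply: uV.
  exists (\row_i if unlift ord0 i is Some j then v 0 j else v0) => i.
  by rewrite mxE; case: unliftP => [j|] -> //; rewrite -(uv j) mxE.
have du : mxinv (diag_mx u) (diag_mx v).
  split; rewrite mulmx_diag -diag_const_mx; congr diag_mx; apply/rowP=> i.
    by rewrite !mxE uv.
  by rewrite !mxE mulrC uv.
have:= mxeqv_mul (diag_mx d) (mxinv1 n) du.
rewrite mul1mx mulmx_diag; congr (mxeqv _ (diag_mx _)).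
Qed.

(* [[x, 0], [e, t]] = [[1, x/e], [0, 1]] diag(x t, 1) [[0, -1/e], [e, t]] *)
Lemma mxeqv_pivot2 (x t e f : R) : e * f = 1 ->
  mxeqv (\matrix_(i < 2, j < 2) if i == j then (if i == 0 then x * t else 1) else 0)
    (\matrix_(i < 2, j < 2) if i == j then (if i == 0 then x else t)
       else if i == 0 then 0 else e).
Proof.
move=> ef; pose mk (a b c d : R) : 'M_2 :=
  \matrix_(i, j) if i == 0 then (if j == 0 then a else b)
                 else (if j == 0 then c else d).
have mkM a b c d a' b' c' d' : mk a b c d *m mk a' b' c' d' =
    mk (a * a' + b * c') (a * b' + b * d') (c * a' + d * c') (c * b' + d * d').
  apply/matrixP=> i j; rewrite !mxE !big_ord_recl big_ord0 !mxE /= addr0.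
  by case: eqP => _; case: eqP.
have mk1 : mk 1 0 0 1 = 1%:M.
  apply/matrixP=> i j; rewrite !mxE.
  by case: i j => [[|[|[]]]] // ? [[|[|[]]]].
have ig : mxinv (mk 1 (x * f) 0 1) (mk 1 (- (x * f)) 0 1).
  by split; rewrite mkM -mk1; congr mk; ring.
have ih : mxinv (mk 0 (- f) e t) (mk t f (- e) 0).
  by split; rewrite mkM -mk1; congr mk; ring: ef.
have:= mxeqv_mul (mk (x * t) 0 0 1) ig ih.
rewrite !mkM; congr mxeqv; apply/matrixP => -[[|[|[]]]] // ? [[|[|[]]]] // ?;
  rewrite !mxE //=; ring: ef.
Qed.

Lemma mxeqv_tperm m n (i i' : 'I_m) (j j' : 'I_n) (A : 'M[R]_(m, n)) :
  mxeqv A (xrow i i' (xcol j j' A)).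
Proof.
have tt p (k l : 'I_p) : mxinv (tperm_mx k l : 'M[R]_p) (tperm_mx k l).
  by split; rewrite -perm_mxM tperm2 perm_mx1.
by rewrite xrowE xcolE mulmxA; apply: mxeqv_mul.
Qed.

Lemma mxeqv_block1 m n (a : R) (D E : 'M_(m, n)) : mxeqv D E ->
  mxeqv (block_mx a%:M 0 0 D : 'M_(1 + m, 1 + n)) (block_mx a%:M 0 0 E).
Proof.
move=> [g [g' [h [h' [[gg' g'g] [hh' h'h] ->]]]]].
have blk p (k k' : 'M[R]_p) : k *m k' = 1%:M -> k' *m k = 1%:M ->
  mxinv (block_mx 1%:M 0 0 k : 'M_(1 + p)) (block_mx 1%:M 0 0 k').
  move=> kk' k'k; split; rewrite mulmx_block !(mulmx1, mulmx0, mul0mx, addr0, add0r).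
    by rewrite kk' -scalar_mx_block.
  by rewrite k'k -scalar_mx_block.
have:= mxeqv_mul (block_mx a%:M 0 0 D) (blk _ _ _ gg' g'g) (blk _ _ _ hh' h'h).
by rewrite !mulmx_block !(mulmx1, mulmx0, mul0mx, mul1mx, addr0, add0r).
Qed.

Lemma mxeqv_clear m n (A : 'M[R]_(m.+1, n.+1)) u : A 0 0 * u = 1 ->
  exists B : 'M_(m, n), mxeqv A (block_mx 1%:M 0 0 B : 'M_(1 + m, 1 + n)).
Proof.
move=> Au; pose B : 'M_(1 + m, 1 + n) := A.
pose b := ursubmx B; pose c := dlsubmx B; pose D := drsubmx B.
have BE : B = block_mx (A 0 0)%:M b c D.
  rewrite -[LHS]submxK; congr block_mx; apply/matrixP=> i j; rewrite !ord1 !mxE.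
  by congr (A _ _); apply: val_inj.
(* The Schur complement of the pivot. The right factor [ih] makes the pivot 1 and clears the first
   row; the left factor [ig] clears the first column. *)
exists (D - u *: (c *m b)).
have ih : mxinv (block_mx u%:M (- u *: b) 0 1%:M : 'M_(1 + n))
                (block_mx (A 0 0)%:M b 0 1%:M).
  split; rewrite mulmx_block !(mulmx1, mulmx0, mul0mx, mul1mx, addr0, add0r).
    rewrite -scalar_mxM mulrC Au mul_scalar_mx scaleNr subrr.
    by rewrite -scalar_mx_block.
  rewrite -scalar_mxM Au mul_scalar_mx scalerA mulrN Au scaleN1r addNr.
  by rewrite -scalar_mx_block.
have ig : mxinv (block_mx 1%:M 0 (- u *: c) 1%:M : 'M_(1 + m))
                (block_mx 1%:M 0 (u *: c) 1%:M).
  by split; rewrite mulmx_block !(mulmx1, mulmx0, mul0mx, mul1mx, addr0, add0r);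
    rewrite scaleNr ?subrr ?addNr -scalar_mx_block.
have:= mxeqv_mul B ig ih; congr mxeqv.
rewrite BE -mulmxA !mulmx_block !(mulmx1, mulmx0, mul0mx, mul1mx, addr0, add0r).
rewrite -scalar_mxM Au mul_scalar_mx scalerA mulrN Au scaleN1r addNr.
rewrite mulmx0 add0r mulmx1 mul_mx_scalar -!scalemxAr scaleNr addNr.
by rewrite scaleNr addrC.
Qed.

(* Cauchy-Binet, without grouping the injections with the same image. *)
Lemma det_mulmx_expand k m (A : 'M[R]_(k, m)) (B : 'M[R]_(m, k)) :
  \det (A *m B) = \sum_(f : {ffun 'I_k -> 'I_m} | injectiveb f)
     (\prod_i A i (f i)) * \det (\matrix_(i, j) B (f i) j).
Proof.
transitivity (\sum_(f : {ffun 'I_k -> 'I_m})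
     (\prod_i A i (f i)) * \det (\matrix_(i, j) B (f i) j)).
  rewrite /determinant; under [RHS]eq_bigr do rewrite mulr_sumr.
  rewrite exchange_big /=; apply: eq_bigr => s _.
  under eq_bigr do rewrite mxE.
  rewrite bigA_distr_bigA mulr_sumr; apply: eq_bigr => f _.
  rewrite mulrCA; congr (_ * _); rewrite -big_split /=.
  by apply: eq_bigr => i _; rewrite !mxE.
rewrite [LHS](bigID (fun f : {ffun 'I_k -> 'I_m} => injectiveb f)) /=.
rewrite [X in _ + X]big1 ?addr0 // => f /injectivePn[i [j ij fij]].
rewrite [\det _](determinant_alternate ij) ?mulr0 // => l.
by rewrite !mxE fij.
Qed.

End MatrixEquivalence.

(** * Smith normal form over power series *)

Section InvariantFactors.
Variable F : fieldType.
Local Notation ser := (ser F).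
Local Notation tp := (@tp F).

Definition tpe (e : enat) : ser := if e is Fin n then tp n else 0.

Lemma tpeD (e f : enat) : tpe (enat_add e f) = tpe e * tpe f.
Proof.
by case: e f => [m|] [n|] /=; rewrite ?mul0r ?mulr0 //; apply: tpD.
Qed.

Lemma tpe_mul_low e (a : ser) n : ~~ enat_le e (Fin n) -> (tpe e * a) n = 0.
Proof.
by case: e => [m|] /= mn; rewrite ?mul0r // tp_mulE (negbTE mn).
Qed.

(** Exponents are indexed by all naturals so that an induction on the size can shift them. *)
Definition sdiag m n (lam : nat -> enat) : 'M[ser]_(m, n) :=
  \matrix_(i, j) if i == j :> nat then tpe (lam i) else 0.

(** Divisibility of all entries by [t^d] survives multiplication by matrices on both sides. *)
Lemma sdiag_dvd m n d lam (A : 'M[ser]_(m, n)) i : (i < m <= n)%N ->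
  mxeqv (tp d *: A) (sdiag m n lam) -> enat_le (Fin d) (lam i).
Proof.
move=> /andP[im mn] [g [g' [h [h' [_ _]]]]].
rewrite -scalemxAr -scalemxAl => /matrixP /(_ (Ordinal im) (Ordinal (leq_trans im mn))).
rewrite !mxE eqxx /=; case: (lam i) => [e|] //= /(congr1 (fun a : ser => a e)).
rewrite tpE eqxx tp_mulE; case: leqP => // _ /eqP.
by rewrite oner_eq0.
Qed.

(** Elimination with a pivot of least order [d]: factoring out [t^d] leaves a unit entry, which is
    moved to the corner and used to clear its row and column. *)
Lemma smith_form m n (A : 'M[ser]_(m, n)) : (m <= n)%N ->
  exists2 lam : nat -> enat,
    forall i j, (i <= j < m)%N -> enat_le (lam i) (lam j) &
    mxeqv A (sdiag m n lam).
Proof.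
elim: m n A => [|m IH] [|n] A // mn.
- exists (fun=> Inf) => //; rewrite (_ : sdiag _ _ _ = A); first exact: mxeqv_refl.
  by apply/matrixP => -[].
- exists (fun=> Inf) => //; rewrite (_ : sdiag _ _ _ = A); first exact: mxeqv_refl.
  by apply/matrixP => -[].
have [A0|An0] := pselect (A = 0).
  exists (fun=> Inf) => //; rewrite (_ : sdiag _ _ _ = A); first exact: mxeqv_refl.
  by rewrite A0; apply/matrixP => i j; rewrite !mxE; case: eqP.
pose P k := [exists i, exists j, A i j k != 0].
have exP : exists k, P k.
  apply: contrapT => nP; apply: An0; apply/matrixP => i j; rewrite mxE.
  apply: serP => k; apply/eqP; rewrite -[_ == _]negbK; apply/negP => Ak; apply: nP.
  by exists k; apply/existsP; exists i; apply/existsP; exists j.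
case: (ex_minnP exP) => d /existsP[i0 /existsP[j0 Ad]] dmin.
have [A' AE] : exists A' : 'M_(m.+1, n.+1), A = tp d *: A'.
  have H i j : {b | A i j = tp d * b}.
    apply: cid; apply: tp_dvd => k kd; apply/eqP; rewrite -[_ == _]negbK.
    apply/negP => Ak; suff /dmin : P k by rewrite leqNgt kd.
    by apply/existsP; exists i; apply/existsP; exists j.
  by exists (\matrix_(i, j) sval (H i j)); apply/matrixP => i j; rewrite !mxE; case: (H i j).
have [u Au] : exists u, A' i0 j0 * u = 1.
  by apply: ser_inv; move: Ad; rewrite AE mxE tp_mulE leqnn subnn.
have A1 := mxeqv_tperm ord0 i0 ord0 j0 A'.
have [|B A1B] := @mxeqv_clear _ _ _ (xrow ord0 i0 (xcol ord0 j0 A')) u.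
  by rewrite !mxE !tpermL.
have {A1 A1B}AB := mxeqv_trans A1 A1B.
(* Keeping the factor [t^d] in the remaining block avoids shifting exponents and bounds them below
   by [d]. *)
have [lam' lamP BE] := IH _ (tp d *: B) mn.
exists (fun i => if i is i'.+1 then lam' i' else Fin d).
  move=> [|i] [|j] //=.
    by move=> jm; apply: sdiag_dvd BE; rewrite -ltnS jm.
  exact: lamP.
have := mxeqv_block1 (tp d) BE; rewrite AE.
have := mxeqv_scale (tp d) AB.
rewrite (@scale_block_mx _ 1 m 1 n) !scaler0 scalemx1 => T1 T2; apply: mxeqv_trans T1 _.
move: T2; congr mxeqv; apply/matrixP => i j.
rewrite [LHS]mxE; case: splitP => i' ii'; rewrite [LHS]mxE; case: splitP => j' jj'.
- by rewrite !mxE ii' jj' !ord1.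
- by rewrite !mxE ii' jj' !ord1.
- by rewrite !mxE ii' jj' !ord1.
- by rewrite !mxE ii' jj' !add1n.
Qed.

End InvariantFactors.

(** * Matrices selecting rows and columns *)

Section Selection.
Variables (R : comNzRingType) (k n : nat) (f : 'I_k -> 'I_n).

Definition selmx : 'M[R]_(k, n) := \matrix_(a, x) (x == f a)%:R.

Lemma selmx_diag (v : 'rV_n) :
  selmx *m diag_mx v = diag_mx (\row_a v 0 (f a)) *m selmx.
Proof.
rewrite mul_mx_diag mul_diag_mx; apply/matrixP => a x; rewrite !mxE.
by case: eqP => [->|_]; rewrite ?mulr0 ?mul0r // mulrC.
Qed.

Lemma diag_selmxT (v : 'rV_n) :
  diag_mx v *m selmx^T = selmx^T *m diag_mx (\row_a v 0 (f a)).
Proof. by apply: trmx_inj; rewrite !trmx_mul trmxK !tr_diag_mx selmx_diag. Qed.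

Hypothesis f_inj : injective f.

Lemma selmxK : selmx *m selmx^T = 1%:M.
Proof.
apply/matrixP => a b; rewrite !mxE (bigD1 (f a)) //= !mxE eqxx mul1r big1.
  by rewrite addr0 (inj_eq f_inj).
by move=> x xa; rewrite !mxE (negbTE xa) mul0r.
Qed.

Lemma selmx_supp (w : 'rV_n) : (forall x, x \notin codom f -> w 0 x = 0) ->
  selmx^T *m diag_mx (\row_a w 0 (f a)) *m selmx = diag_mx w.
Proof.
move=> w0; rewrite -diag_selmxT -mulmxA mul_diag_mx; apply/matrixP => x y.
rewrite !mxE; have [/codomP[a ->]|/w0 ->] := boolP (x \in codom f); last first.
  by rewrite mul0r mul0rn.
rewrite (bigD1 a) //= !mxE eqxx mul1r big1 ?addr0 => [|b ba].
  by rewrite eq_sym mulr_natr.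
by rewrite !mxE (inj_eq f_inj) eq_sym (negbTE ba) mul0r.
Qed.

End Selection.

(** * Elementary degenerations of diagonal matrices *)

Section Degenerations.
Variable F : fieldType.
Local Notation ser := (ser F).
Local Notation tp := (@tp F).
Local Notation tpe := (@tpe F).

Definition dmx r s (lam : 'I_r -> enat) : 'M[ser]_(r, s) :=
  \matrix_(i, j) if (j : nat) == (s - r + i)%N then tpe (lam i) else 0.

Lemma dmxE r s (hrs : (r <= s)%N) : exists2 J : 'M[ser]_(r, s),
  J *m J^T = 1%:M & forall lam, dmx s lam = diag_mx (\row_i tpe (lam i)) *m J.
Proof.
have lt_rs (i : 'I_r) : (s - r + i < s)%N by have := ltn_ord i; lia.
(* [J] selects the last [r] columns. *)
exists (selmx ser (fun i => Ordinal (lt_rs i))).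
  apply: selmxK => i j /(congr1 val) /= /addnI; exact: val_inj.
move=> lam; rewrite mul_diag_mx; apply/matrixP => i j; rewrite !mxE -val_eqE /=.
by case: eqP; rewrite ?mulr1 ?mulr0.
Qed.

(** Reversing the order of rows and columns moves the diagonal to the last columns and reverses the
    exponents. *)
Lemma sdiag_dmx r s l (hrs : (r <= s)%N) :
  mxeqv (sdiag F r s l) (dmx s (fun i : 'I_r => l (rev_ord i))).
Proof.
pose rv n : {perm 'I_n} := perm (@rev_ord_inj n).
have ip n (p : {perm 'I_n}) : mxinv (perm_mx p : 'M[ser]_n) (perm_mx p^-1%g).
  by split; rewrite -perm_mxM ?mulgV ?mulVg ?perm_mx1.
have := mxeqv_mul (sdiag F r s l) (ip _ (rv r)) (ip _ (rv s)^-1%g).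
rewrite -row_permE -col_permE; congr mxeqv; apply/matrixP => i j.
rewrite !mxE !permE /=; have := ltn_ord i; have := ltn_ord j => js ir.
rewrite (_ : (_ == _) = ((j : nat) == (s - r + i)%N)) //.
by apply/eqP/eqP; lia.
Qed.

Lemma degen_diag r s (lam lam' : 'I_r -> nat) (B : 'M[ser]_r) (e : F) :
  mxeqv (diag_mx (\row_i tp (lam i))) (diag_mx (\row_i tp (lam' i)) + cst e *: B) ->
  forall J, (forall lam, dmx s lam = diag_mx (\row_i tpe (lam i)) *m J) ->
  J *m J^T = 1%:M ->
  mxeqv (dmx s (Fin \o lam)) (dmx s (Fin \o lam') + cst e *: (B *m J)).
Proof.
move=> H J dJ JJ; rewrite !dJ scalemxAl -mulmxDl; apply: mxeqv_rowfree JJ _.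
exact: H.
Qed.

Lemma degen_add_unit r s (hrs : (r <= s)%N) (lam : 'I_r -> nat) k :
  exists B : 'M[ser]_(r, s), forall e, e != 0 ->
    mxeqv (dmx s (Fin \o lam)) (dmx s (Fin \o add_unit lam k) + cst e *: B).
Proof.
have [J JJ dJ] := dmxE hrs.
(* With [b = lam k], the product [t^b (t + e)] is [t^(b+1) + e t^b]; the factor [t + e] is a unit
   because its constant term is [e]. *)
exists (diag_mx (\row_i if i == k then tp (lam k) else 0) *m J) => e e0.
apply: degen_diag => //.
pose u : 'rV[ser]_r := \row_i if i == k then tp 1 + cst e else 1.
have uV i : exists w, u 0 i * w = 1.
  rewrite mxE; case: eqP => _; last by exists 1; rewrite mulr1.
  by apply: ser_inv; rewrite ser_addE tpE add0r.
have := mxeqv_diag_unit (\row_i tp (lam i)) uV; congr mxeqv.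
rewrite -linearZ -raddfD; congr diag_mx; apply/rowP => i; rewrite !mxE /add_unit.
case: eqP => [->|_]; last by rewrite addn0 mulr1 mulr0 addr0.
by rewrite mulrDr -tpD [in RHS]mulrC.
Qed.

Lemma degen_move_unit r s (hrs : (r <= s)%N) (lam : 'I_r -> nat) i k :
  (lam k + 2 <= lam i)%N ->
  exists B : 'M[ser]_(r, s), forall e, e != 0 ->
    mxeqv (dmx s (Fin \o lam)) (dmx s (Fin \o move_unit lam i k) + cst e *: B).
Proof.
move=> ki; have [J JJ dJ] := dmxE hrs.
have ik : i != k by apply: contraTneq ki => ->; lia.
pose f (a : 'I_2) := if a == 0 then i else k.
have f_inj : injective f.
  rewrite /f => -[[|[|[]]]] // p [[|[|[]]]] //= q; do ?by move=> _; apply: val_inj.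
    by move=> E; rewrite E eqxx in ik.
  by move=> E; rewrite E eqxx in ik.
pose P := selmx ser f; pose v := \row_l tp (lam l); pose v' := \row_l tp (move_unit lam i k l).
(* [X] is the part of the diagonal away from [i] and [k], which moving the unit leaves unchanged. *)
have [X [PX XP vE]] : exists X : 'M[ser]_r, [/\ P *m X = 0, X *m P^T = 0 &
    diag_mx v = X + P^T *m diag_mx (\row_a v 0 (f a)) *m P].
  exists (diag_mx v - P^T *m diag_mx (\row_a v 0 (f a)) *m P); split.
  - by rewrite mulmxBr !mulmxA selmxK // mul1mx selmx_diag subrr.
  - by rewrite mulmxBl -!mulmxA selmxK // mulmx1 diag_selmxT subrr.
  - by rewrite subrK.
have v'E : diag_mx v' = X + P^T *m diag_mx (\row_a v' 0 (f a)) *m P.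
  have -> : v' = v + (v' - v) by rewrite addrC subrK.
  rewrite raddfD /= {1}vE -addrA -(selmx_supp f_inj (w := v' - v)).
    congr (_ + _); rewrite -mulmxDl -mulmxDr -raddfD; congr (_ *m diag_mx _ *m _).
    by apply/rowP => a; rewrite !mxE.
  move=> x xf; rewrite /v /v' 4!mxE.
  suff -> : move_unit lam i k x = lam x by rewrite subrr.
  have /negbTE xi : x != i by apply: contraNneq xf => ->; apply/codomP; exists 0.
  have /negbTE xk : x != k by apply: contraNneq xf => ->; apply/codomP; exists 1.
  by rewrite /move_unit xi xk addn0 subn0.
(* In the block with index 0 for [i] and 1 for [k], the perturbation is the entry [e t^(lam k)]
   below the diagonal. *)
exists (P^T *m (tp (lam k) *: delta_mx 1 0) *m P *m J) => e e0.
apply: degen_diag => //; rewrite -/v -/v' vE v'E.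
rewrite -addrA (scalemxAl _ (P^T *m _) P) (scalemxAr _ P^T) -mulmxDl -mulmxDr.
apply: mxeqv_embed PX XP _; [exact: selmxK | exact: selmxK |].
have cee : cst e * cst e^-1 = 1 by rewrite -rmorphM divff ?rmorph1.
have tpI m n : m = n -> tp m = tp n by move=> ->.
(* With [x = t^(lam i - lam k - 1)], scaling by [t^(lam k)] turns [diag(x t, 1)] into the old
   exponents and the diagonal [x, t] into the new ones. *)
have := mxeqv_scale (tp (lam k)) (mxeqv_pivot2 (tp (lam i - lam k - 1)%N) (tp 1) cee).
congr mxeqv; apply/matrixP => -[[|[|[]]]] // p [[|[|[]]]] // q;
  rewrite !mxE //= ?mulr0 ?mul0r ?mulr1 ?addr0 ?mulr0n // ?mulr1n.
- by rewrite -!tpD; apply: tpI; rewrite /f /=; lia.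
- by rewrite -tpD; apply: tpI; rewrite /move_unit /f /= eqxx (negbTE ik); lia.
- by rewrite add0r mulrC.
- by rewrite -tpD; apply: tpI; rewrite /move_unit /f /= eqxx eq_sym (negbTE ik) subn0.
Qed.

End Degenerations.

(** * Arcs as matrices over the power series ring, and orbits as equivalence classes *)

Local Notation S := (ser CC).

Definition mxof m n (A : psmx m n) : 'M[S]_(m, n) := \matrix_(i, j) (A i j : S).
Definition psof m n (A : 'M[S]_(m, n)) : psmx m n := fun i j => A i j.

Lemma mxofK m n (A : psmx m n) : psof (mxof A) = A.
Proof. by apply/funext => i; apply/funext => j; rewrite /psof mxE. Qed.

Lemma psofK m n (A : 'M[S]_(m, n)) : mxof (psof A) = A.
Proof. by apply/matrixP => i j; rewrite mxE. Qed.

Lemma psof_mul m n p (A : 'M[S]_(m, n)) (B : 'M[S]_(n, p)) :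
  psof (A *m B) = psmx_mul (psof A) (psof B).
Proof.
by apply/funext => i; apply/funext => j; apply/funext => k; rewrite /psof mxE ser_sumE.
Qed.

Lemma psof_id n : psof (1%:M : 'M[S]_n) = @psmx_id n.
Proof.
by apply/funext => i; apply/funext => j; rewrite /psof mxE /psmx_id; case: eqP.
Qed.

Lemma mxof_mul m n p (A : psmx m n) (B : psmx n p) :
  mxof (psmx_mul A B) = mxof A *m mxof B.
Proof. by rewrite -{1}(mxofK A) -{1}(mxofK B) -psof_mul psofK. Qed.

Lemma psmx_inverseP n (g g' : 'M[S]_n) : psmx_inverse (psof g) (psof g') <-> mxinv g g'.
Proof.
rewrite /psmx_inverse -!psof_mul -psof_id; split=> -[E E']; split.
- by rewrite -[LHS]psofK E psofK.
- by rewrite -[LHS]psofK E' psofK.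
- by rewrite E.
- by rewrite E'.
Qed.

Lemma Goo_orbitP r s (A B : arcM r s) : Goo_orbit A B <-> mxeqv (mxof A) (mxof B).
Proof.
split=> [[g [g' [h [h' [gg' [hh' ->]]]]]]|[g [g' [h [h' [gg' hh' E]]]]]].
  (* The group acts on the right through the inverse, so [h] and [h'] exchange roles. *)
  exists (mxof g), (mxof g'), (mxof h'), (mxof h).
  split; last by rewrite !mxof_mul.
    by apply/psmx_inverseP; rewrite !mxofK.
  by apply/psmx_inverseP; rewrite !mxofK; case: hh'.
exists (psof g), (psof g'), (psof h'), (psof h).
split; first exact/psmx_inverseP.
split; first by apply/psmx_inverseP; case: hh'.
by rewrite -[LHS]mxofK E !psof_mul mxofK.
Qed.

Lemma mxof_delta r s lam : mxof (@delta r s lam) = dmx CC s lam.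
Proof.
apply/matrixP => i j; rewrite !mxE /delta; case: eqP => // _.
Qed.

Lemma O_orbitP r s lam (A : arcM r s) : O_orbit s lam A <-> mxeqv (dmx CC s lam) (mxof A).
Proof. by rewrite -mxof_delta; apply: Goo_orbitP. Qed.

(** * Regular functions on the arc space and closures of orbits *)

Section PolynomialFunctions.
Variables r s : nat.
Implicit Types (f : arcM r s -> CC) (u : arcM r s -> S).

(** Working with functions instead of syntax trees lets coefficients of determinants and matrix
    products count as regular functions. *)
Definition polyfun f := exists p, forall A, arc_eval p A = f A.
Definition polyser u := forall k, polyfun (fun A => u A k).

Lemma polyfun_const c : polyfun (fun=> c).
Proof. by exists (APConst _ _ c). Qed.

Lemma polyfunD f f' : polyfun f -> polyfun f' -> polyfun (fun A => f A + f' A).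
Proof. by move=> [p pf] [q qf]; exists (APAdd p q) => A /=; rewrite pf qf. Qed.

Lemma polyfunM f f' : polyfun f -> polyfun f' -> polyfun (fun A => f A * f' A).
Proof. by move=> [p pf] [q qf]; exists (APMul p q) => A /=; rewrite pf qf. Qed.

Lemma eq_polyfun f f' : f =1 f' -> polyfun f -> polyfun f'.
Proof. by move=> ff' [p pf]; exists p => A; rewrite pf ff'. Qed.

Lemma polyfun_sum (I : Type) (t : seq I) (P : pred I) (f : I -> arcM r s -> CC) :
  (forall i, polyfun (f i)) -> polyfun (fun A => \sum_(i <- t | P i) f i A).
Proof.
move=> fP; elim: t => [|i t IH].
  by apply: eq_polyfun (polyfun_const 0) => A; rewrite big_nil.
case Pi: (P i).
  by apply: eq_polyfun (polyfunD (fP i) IH) => A; rewrite big_cons Pi.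
by apply: eq_polyfun IH => A; rewrite big_cons Pi.
Qed.

Lemma polyser_const c : polyser (fun=> c).
Proof. by move=> k; apply: polyfun_const. Qed.

Lemma polyserM u v : polyser u -> polyser v -> polyser (fun A => u A * v A).
Proof. by move=> uP vP k; apply: polyfun_sum => i; apply: polyfunM. Qed.

Lemma polyser_sum (I : Type) (t : seq I) (P : pred I) (u : I -> arcM r s -> S) :
  (forall i, polyser (u i)) -> polyser (fun A => \sum_(i <- t | P i) u i A).
Proof.
move=> uP k; apply: eq_polyfun (polyfun_sum t P (fun i => uP i k)) => A.
by rewrite ser_sumE.
Qed.

Lemma polyser_prod (I : Type) (t : seq I) (u : I -> arcM r s -> S) :
  (forall i, polyser (u i)) -> polyser (fun A => \prod_(i <- t) u i A).
Proof.
move=> uP; elim: t => [|i t IH] k.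
  by apply: eq_polyfun (polyser_const 1 k) => A; rewrite big_nil.
by apply: eq_polyfun (polyserM (uP i) IH k) => A; rewrite big_cons.
Qed.

Lemma polyser_entry i j : polyser (fun A => mxof A i j).
Proof. by move=> k; exists (APVar i j k) => A; rewrite mxE. Qed.

Lemma polyser_det n (U : arcM r s -> 'M[S]_n) :
  (forall i j, polyser (fun A => U A i j)) -> polyser (fun A => \det (U A)).
Proof.
move=> UP; apply: polyser_sum => p; apply: polyserM; first exact: polyser_const.
exact: polyser_prod.
Qed.

Lemma polyser_mulmx (g : 'M_r) (h : 'M_s) i j : polyser (fun A => (g *m mxof A *m h) i j).
Proof.
have H : polyser (fun A => \sum_l (\sum_m g i m * mxof A m l) * h l j).
  apply: polyser_sum => l; apply: polyserM; last exact: polyser_const.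
  apply: polyser_sum => m; apply: polyserM; last exact: polyser_entry.
  exact: polyser_const.
move=> k; apply: eq_polyfun (H k) => A; congr (_ k); rewrite mxE.
by apply: eq_bigr => l _; rewrite mxE.
Qed.

Lemma polyfun_comp p (phi : arcM r s -> arcM r s) :
  (forall i j, polyser (fun A => phi A i j)) -> polyfun (fun A => arc_eval p (phi A)).
Proof.
move=> phiP; elim: p => [c|i j k|p IHp q IHq|p IHp q IHq] /=.
- exact: polyfun_const.
- exact: phiP.
- exact: polyfunD.
- exact: polyfunM.
Qed.

Lemma arc_eval_local (p : arc_poly r s) : exists N, forall A B : arcM r s,
  (forall i j k, (k < N)%N -> A i j k = B i j k) -> arc_eval p A = arc_eval p B.
Proof.
elim: p => [c|i j k|p [N NP] q [M MP]|p [N NP] q [M MP]] /=.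
- by exists 0%N.
- by exists k.+1 => A B; apply.
- exists (maxn N M) => A B AB; congr (_ + _); [apply: NP|apply: MP] => i j k kN;
    by apply: AB; rewrite leq_max kN ?orbT.
- exists (maxn N M) => A B AB; congr (_ * _); [apply: NP|apply: MP] => i j k kN;
    by apply: AB; rewrite leq_max kN ?orbT.
Qed.

Lemma arc_eval_line p (A B : 'M[S]_(r, s)) :
  exists Q : {poly CC}, forall e, Q.[e] = arc_eval p (psof (A + cst e *: B)).
Proof.
elim: p => [c|i j k|p [P PP] q [Q QP]|p [P PP] q [Q QP]] /=.
- by exists c%:P => e; rewrite hornerC.
- exists ((A i j k)%:P + 'X * (B i j k)%:P) => e.
  by rewrite /psof !mxE ser_addE cst_mulE hornerD hornerM !hornerC hornerX.
- by exists (P + Q) => e; rewrite hornerD PP QP.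
- by exists (P * Q) => e; rewrite hornerM PP QP.
Qed.

Lemma CC_natr_inj : injective (fun n : nat => n%:R : CC).
Proof. by move=> m n /eqP; rewrite (@eqr_nat (Rdefinitions.R[i] : numDomainType)) => /eqP. Qed.

Lemma poly_root_nonzero (Q : {poly CC}) : (forall e, e != 0 -> Q.[e] = 0) -> Q = 0.
Proof.
move=> Q0; apply/eqP/negP => /negP Qn0.
(* The integers from 1 to [size Q] are distinct nonzero roots, one more than the degree allows. *)
have := @max_poly_roots _ Q [seq n.+1%:R | n <- iota 0 (size Q)] Qn0.
rewrite size_map size_iota ltnn => H; apply: notF; apply: H.
  apply/allP => _ /mapP[n _ ->]; apply/eqP/Q0; apply/eqP.
  by move=> /(@CC_natr_inj _ 0%N).
by rewrite map_inj_uniq ?iota_uniq // => m n /CC_natr_inj [].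
Qed.

(** On a line a regular function is a polynomial in [e]; vanishing for all nonzero [e], it vanishes
    at 0. *)
Lemma closure_line (Y : arcM r s -> Prop) (A B : 'M[S]_(r, s)) :
  (forall e, e != 0 -> Y (psof (A + cst e *: B))) -> in_zariski_closure Y (psof A).
Proof.
move=> YAB p p0; have [Q QE] := arc_eval_line p A B.
have := QE 0; rewrite (poly_root_nonzero (Q := Q)) => [|e e0]; last by rewrite QE; apply/p0/YAB.
by rewrite horner0 raddf0 scale0r addr0.
Qed.

(** The group preserves the orbit, so pulling back along a group element keeps the functions that
    vanish on it. *)
Lemma closure_mxeqv lam (A B : arcM r s) : mxeqv (mxof A) (mxof B) ->
  in_zariski_closure (O_orbit s lam) A -> in_zariski_closure (O_orbit s lam) B.
Proof.
move=> [g [g' [h [h' [gg' hh' E]]]]] clA p p0.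
have [q qE] := polyfun_comp p (phi := fun A => psof (g *m mxof A *m h)) (polyser_mulmx g h).
rewrite -(mxofK B) E -qE; apply: clA => C /O_orbitP OC; rewrite qE; apply: p0.
apply/O_orbitP; rewrite psofK; apply: mxeqv_trans OC _; exact: mxeqv_mul gg' hh'.
Qed.

Lemma closure_trans (Y Z : arcM r s -> Prop) A :
  (forall B, Y B -> in_zariski_closure Z B) ->
  in_zariski_closure Y A -> in_zariski_closure Z A.
Proof. by move=> YZ clA p p0; apply: clA => B /YZ; apply. Qed.

(** It suffices to reach the orbit of [nu'], hence by invariance its diagonal point, which is the
    limit of a line whose other points lie in the orbit of [nu]. *)
Lemma closure_degen (nu nu' : 'I_r -> nat) (B : 'M[S]_(r, s)) A :
  (forall e, e != 0 -> mxeqv (dmx CC s (Fin \o nu)) (dmx CC s (Fin \o nu') + cst e *: B)) ->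
  in_zariski_closure (O_orbit s (Fin \o nu')) A ->
  in_zariski_closure (O_orbit s (Fin \o nu)) A.
Proof.
move=> H; apply: closure_trans => C /O_orbitP; rewrite -{1}(psofK (dmx _ _ _)) => eqC.
apply: closure_mxeqv eqC _; apply: (@closure_line _ _ B) => e /H eB.
by apply/O_orbitP; rewrite psofK.
Qed.

End PolynomialFunctions.

(** * Codomination implies containment in the closure *)

Section Sufficiency.
Variables (r s : nat) (hrs : (r <= s)%N).

Lemma codominates_nat_closure (lam mu : 'I_r -> nat) :
  (forall i j : 'I_r, (i <= j)%N -> (mu j <= mu i)%N) ->
  (forall j : 'I_r, (ntail lam j <= ntail mu j)%N) ->
  in_zariski_closure (O_orbit s (Fin \o lam)) (psof (dmx CC s (Fin \o mu))).
Proof.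
move=> mu_dec; move: lam; apply: (domination_ind mu_dec).
- move=> p; apply; apply/O_orbitP; rewrite psofK; exact: mxeqv_refl.
- by move=> lam k; have [B] := degen_add_unit CC hrs lam k; apply: closure_degen.
- by move=> lam i k ik; have [B] := degen_move_unit CC hrs ik; apply: closure_degen.
Qed.

Lemma dmx_odflt N (lam : 'I_r -> enat) : exists C,
  dmx CC s lam = dmx CC s (Fin \o (enat_odflt N \o lam)) + tp CC N *: C.
Proof.
(* At an infinite exponent the truncated matrix has [t^N], which the coefficient -1 cancels;
   elsewhere the correction is zero. *)
exists (- dmx CC s (fun i => if lam i is Fin _ then Inf else Fin 0)).
apply/matrixP => i j; rewrite !mxE; case: eqP => _; last by rewrite oppr0 mulr0 addr0.
rewrite /comp; case: (lam i) => [n|] /=; last by rewrite tp0 mulrN1 subrr.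
by rewrite oppr0 mulr0 addr0.
Qed.

Lemma codominates_closure (lam mu : 'I_r -> enat) :
  prepartition lam -> prepartition mu -> codominates lam mu ->
  forall B, O_orbit s mu B -> in_zariski_closure (O_orbit s lam) B.
Proof.
move=> lam_dec mu_dec dom B /O_orbitP; rewrite -{1}(psofK (dmx _ _ _)) => muB.
apply: closure_mxeqv muB _ => p p0.
have [N0 loc] := arc_eval_local p.
(* Large enough that [p] does not see changes by multiples of [t^N], and that [N] bounds the sum of
   the finite exponents of either sequence. *)
pose N := (N0 + \sum_l enat_odflt 0 (lam l) + \sum_l enat_odflt 0 (mu l))%N.
have eval_eq (A : 'M[S]_(r, s)) C : arc_eval p (psof (A + tp CC N *: C)) = arc_eval p (psof A).
  apply: loc => i j k kN; rewrite /psof !mxE ser_addE tp_mulE ifF ?addr0 //.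
  by apply/negbTE; rewrite -ltnNge /N -addnA ltn_addr.
have [C ->] := dmx_odflt N mu; rewrite eval_eq.
apply: (@codominates_nat_closure (enat_odflt N \o lam)).
- by apply: odflt_dec => //; rewrite leq_addl.
- by apply: codominates_odflt => //; rewrite /N -addnA addnCA leq_addr.
(* A point of the truncated orbit is congruent modulo [t^N] to a point of [O_lambda], where [p]
   vanishes. *)
move=> A /O_orbitP[g [g' [h [h' [gg' hh' AE]]]]].
have [C' lamE] := dmx_odflt N lam; rewrite -(mxofK A) AE -(eval_eq _ (g *m C' *m h)).
apply: p0; apply/O_orbitP; rewrite psofK lamE; exists g, g', h, h'; split=> //.
by rewrite mulmxDr mulmxDl -scalemxAr -scalemxAl.
Qed.

End Sufficiency.

(** * Containment in the closure implies codomination, by minors *)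

Section Necessity.
Variables (r s : nat) (hrs : (r <= s)%N).

Lemma tpe_sum (I : finType) (f : I -> enat) :
  tpe CC (\big[enat_add/Fin 0]_i f i) = \prod_i tpe CC (f i).
Proof. by apply: (big_morph (tpe CC)); [exact: tpeD | exact: tp0]. Qed.

Lemma closure_codominates (lam mu : 'I_r -> enat) :
  prepartition lam -> in_zariski_closure (O_orbit s lam) (@delta r s mu) ->
  codominates lam mu.
Proof.
move=> lam_dec clmu j.
have lt_f0 (x : 'I_(r - j)) : (j + x < r)%N by have := ltn_ord x; lia.
have lt_f1 (x : 'I_(r - j)) : (s - r + (j + x) < s)%N by have := ltn_ord x; lia.
(* The last [r - j] rows and columns, where [delta] is diagonal with the exponents of the tail. *)
pose f0 x := Ordinal (lt_f0 x); pose f1 x := Ordinal (lt_f1 x).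
pose minor (A : arcM r s) : S := \det (mxsub f0 f1 (mxof A)).
have minor_poly : polyser minor.
  by apply: polyser_det => x y k; exists (APVar (f0 x) (f1 y) k) => A; rewrite !mxE.
have minor_lam A n : O_orbit s lam A -> ~~ enat_le (tail_sum lam j) (Fin n) -> minor A n = 0.
  move=> /O_orbitP[g [_ [h [_ [_ _ AE]]]]] nle.
  have [J _ lamE] := dmxE CC hrs.
  have -> : minor A = \det (rowsub f0 g *m diag_mx (\row_i tpe CC (lam i)) *m colsub f1 (J *m h)).
    congr (\det _); rewrite AE lamE; apply/matrixP => x y.
    rewrite -!mulmxA mxE !mulmxA -(mulmxA (g *m _)) !mxE; apply: eq_bigr => l _.
    congr (_ * _); last by rewrite [RHS]mxE.
    by rewrite !mxE; apply: eq_bigr => m _; rewrite !mxE.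
  (* Each term contains [t] to the sum of [lam] over [r - j] distinct indices, which is at least the
     tail sum. *)
  rewrite det_mulmx_expand ser_sumE big1 // => f /injectiveP f_inj.
  under eq_bigr do rewrite mul_mx_diag !mxE mulrC.
  rewrite big_split /= -tpe_sum -mulrA tpe_mul_low //.
  apply: contra nle; apply: enat_le_trans; exact: tail_sum_min.
have minor_mu : minor (@delta r s mu) = tpe CC (tail_sum mu j).
  rewrite (@tail_sum_image _ mu j f0) // tpe_sum.
  rewrite /minor mxof_delta (_ : mxsub _ _ _ = diag_mx (\row_x tpe CC (mu (f0 x)))).
    by rewrite det_diag; apply: eq_bigr => x _; rewrite mxE.
  apply/matrixP => x y; rewrite !mxE /= !eqn_add2l eq_sym -val_eqE /=.
  by case: eqP.
case E: (tail_sum mu j) => [n|]; last by case: (tail_sum lam j).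
(* If the tail sum of [lam] exceeded [n], the coefficient of [t^n] in the minor would vanish on
   [O_lambda] but equal 1 at [delta_mu]. *)
apply: contraT => nle; have [p pE] := minor_poly n.
have := clmu p; rewrite pE minor_mu E /= => H.
have : tp CC n n = 0 by apply: H => A OA; rewrite pE; exact: minor_lam.
by move/eqP; rewrite tpE eqxx oner_eq0.
Qed.

End Necessity.

(** * The closure order, and the classification of orbits by pre-partitions *)

Theorem theorem4p7 (r s : nat) (hr : (0 < r)%N) (hrs : (r <= s)%N) :
  (forall lam mu : 'I_r -> enat, prepartition lam -> prepartition mu ->
     ((forall B : arcM r s, O_orbit s mu B -> in_zariski_closure (O_orbit s lam) B)
      <-> codominates lam mu)) /\
  (forall A : arcM r s, exists lam : 'I_r -> enat,
     (prepartition lam /\ O_orbit s lam A) /\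
     forall lam' : 'I_r -> enat, prepartition lam' -> O_orbit s lam' A -> lam' = lam).
Proof.
have delta_in lam : O_orbit s lam (@delta r s lam).
  by apply/O_orbitP; rewrite mxof_delta; apply: mxeqv_refl.
split=> [lam mu lam_dec mu_dec|A].
  split=> [sub|]; last exact: codominates_closure.
  exact/(closure_codominates hrs lam_dec)/sub.
have [l l_inc Al] := smith_form (mxof A) hrs.
pose lam (i : 'I_r) := l (rev_ord i).
have lamA : O_orbit s lam A.
  apply/O_orbitP/mxeqv_sym; apply: mxeqv_trans Al _; exact: sdiag_dmx.
have lam_dec : prepartition lam.
  move=> i j ij; apply: l_inc => /=; have := ltn_ord i; have := ltn_ord j; lia.
exists lam; split=> // lam' lam'_dec lam'A.
(* Two orbits through [A] coincide, so each contains the diagonal point of the other and necessity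
   gives codomination both ways. *)
have le_of (nu nu' : 'I_r -> enat) : prepartition nu ->
    O_orbit s nu A -> O_orbit s nu' A -> codominates nu nu'.
  move=> nu_dec /O_orbitP nuA /O_orbitP nu'A.
  apply: (closure_codominates hrs nu_dec) => p; apply; apply/O_orbitP.
  by rewrite mxof_delta; apply: mxeqv_trans nuA _; apply: mxeqv_sym.
apply: tail_sum_inj => // j; apply: enat_le_anti; exact: le_of.
Qed.
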